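(* Let $m$ be a positive integer and let $r,s$ be indeterminates (constants for $\frac{d}{dt}$). Let $T_2$ be the function, defined up to a nonzero multiplicative constant, attached to the second $\tau$-function $\tau_2$ of the seed solution $q=t+\frac{t(t-1)}{r}\frac{z'}{z}$, $z={}_2F_1(r,-m,s;t)$, as described in the context. Then, up to a nonzero constant factor (independent of $t$), $$T_2=W(r,m,s)=\sum_{j=0}^m(-1)^j\binom{r+m+1-j}{m-j}\binom{s+m}{j}t^{m-j}.$$
   Context: Binomial coefficients are $\binom{x}{k}=x(x-1)\cdots(x-k+1)/k!$. Write $'=\frac{d}{dt}$. Parameters: $b_1=\frac{m+r+1}{2}$, $b_2=\frac{m-r+2s-1}{2}$, $b_3=\frac{r+m-1}{2}$, $b_4=\frac{m-r-1}{2}$ (so $b_1=b_3+1$). Hamiltonian: for a parameter vector $\mathbf b=(b_1,b_2,b_3,b_4)$, $$H(\mathbf b)=\frac{q(q-1)(q-t)}{t(t-1)}\left\{p^2-p\left(\frac{b_1+b_2}{q}+\frac{b_1-b_2}{q-1}+\frac{b_3+b_4}{q-t}\right)+\frac{(b_1+b_3)(b_1+b_4)}{q(q-1)}\right\}.$$ The system $q'=\partial H/\partial p$, $p'=-\partial H/\partial q$ is equivalent to the sixth Painlev\'e equation for $q$ with parameters $\alpha=\frac{(b_3-b_4)^2}{2}$, $\beta=-\frac{(b_1+b_2)^2}{2}$, $\gamma=\frac{(b_1-b_2)^2}{2}$, $\delta=-\frac{(b_3+b_4)(b_3+b_4+2)}{2}$. Given a solution $q$, its conjugate variable is $$p=\frac{t(t-1)q'}{2q(q-1)(q-t)}+\frac12\left\{\frac{b_1+b_2}{q}+\frac{b_1-b_2}{q-1}+\frac{b_3+b_4}{q-t}\right\}.$$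 Okamoto's $+$-construction replaces $\mathbf b$ by $\mathbf b^+=(b_1,b_2,b_3+1,b_4)$ and the solution $q$ by a solution $q^+$ for $\mathbf b^+$; the Hamiltonian function changes according to $$H^+=H-\frac{pq(q-1)-(b_1+b_4)(q-t)}{t(t-1)}.$$ Starting from the seed $q_0=q$ with $\mathbf b_0=\mathbf b$, where $z={}_2F_1(r,-m,s;t)=\sum_{j=0}^m(-1)^j\binom{r+j-1}{j}\binom mj\binom{s+j-1}{j}^{-1}t^j$, let $q_n,p_n,H_n$ denote the objects after $n$ steps, with $\mathbf b_n=(b_1,b_2,b_3+n,b_4)$. For this seed the first step gives $$q_1=\frac{(b_1+b_2)\,t\,(q-1)}{(2b_1t+b_2-b_1)q-(b_1+b_2)t},$$ with $p_1$ the conjugate variable of $q_1$ for parameters $\mathbf b_1$; $$H_1=-\frac{(b_1+b_2)(b_1+b_4)}{t}-\frac{(b_1-b_2)(b_1+b_4)}{t-1};$$ and $$H_2=H_1-\frac{p_1q_1(q_1-1)-(b_1+b_4)(q_1-t)}{t(t-1)}.$$ The $\tau$-function $\tau_n$ is defined up to a multiplicative constant by $H_n=\frac{d}{dt}\log\tau_n$, and $T_n$ is defined by $$\tau_n=\frac{T_n}{t^{(b_1+b_4)(b_1+b_2+n-1)}(t-1)^{(b_1+b_4)(b_1-b_2+n-1)}}.$$ Thus $T_2$ is characterized, up to a nonzero constant, by $$\frac{T_2'}{T_2}=H_2+\frac{(b_1+b_4)(b_1+b_2+1)}{t}+\frac{(b_1+b_4)(b_1-b_2+1)}{t-1}.$$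 *)

(* Defs.v *)
From HB Require Import structures.
From mathcomp Require Import all_boot all_order all_algebra.

Set Implicit Arguments.
Unset Strict Implicit.
Unset Printing Implicit Defensive.

Import GRing.Theory.
Local Open Scope ring_scope.

(* Everything lives in a differential field (L, D) with D = d/dt; functions   *)
(* of t, such as T_2, are elements of L, and "independent of t" means D c = 0.*)
(* The basic model is Q(r, s)(t); L may also be larger, so that T_2 is not    *)
(* assumed to be rational in t.                                               *)

Definition derivation (L : fieldType) (D : L -> L) : Prop :=
  (forall x y, D (x + y) = D x + D y) /\
  (forall x y, D (x * y) = D x * y + x * D y).

(* r and s are algebraically independent over the integers. In particular no  *)
(* nonzero integer vanishes in L, so L has characteristic zero.               *)
Definition indeterminates (L : fieldType) (r s : L) : Prop :=
  forall P : {poly {poly int}},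
    (map_poly (map_poly (intr : int -> L)) P).[r, s] = 0 -> P = 0.

Definition gbinom (L : fieldType) (x : L) (k : nat) : L :=
  (\prod_(i < k) (x - i%:R)) / (k`!)%:R.

Record params (L : fieldType) := Params { b1 : L; b2 : L; b3 : L; b4 : L }.

Definition plus_params (L : fieldType) (b : params L) : params L :=
  Params (b1 b) (b2 b) (b3 b + 1) (b4 b).

Section Okamoto.
Variables (L : fieldType) (D : L -> L) (t : L).

Definition hamiltonian (b : params L) (q p : L) : L :=
  q * (q - 1) * (q - t) / (t * (t - 1)) *
  (p ^+ 2
   - p * ((b1 b + b2 b) / q + (b1 b - b2 b) / (q - 1)
          + (b3 b + b4 b) / (q - t))
   + (b1 b + b3 b) * (b1 b + b4 b) / (q * (q - 1))).

(* The p for which q' = dH/dp. *)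
Definition conjugate (b : params L) (q : L) : L :=
  t * (t - 1) * D q / (2%:R * q * (q - 1) * (q - t))
  + 2%:R^-1 * ((b1 b + b2 b) / q + (b1 b - b2 b) / (q - 1)
               + (b3 b + b4 b) / (q - t)).

(* H^+, where H is the Hamiltonian function of the solution q for b. The      *)
(* coefficient b1 + b4 is unchanged by plus_params.                           *)
Definition plus_H (b : params L) (q H : L) : L :=
  H - (conjugate b q * q * (q - 1) - (b1 b + b4 b) * (q - t)) / (t * (t - 1)).

(* T_n, up to a constant factor:                                              *)
(*   tau_n = T_n / (t ^ ((b1 + b4) (b1 + b2 + n - 1))                         *)
(*                  (t - 1) ^ ((b1 + b4) (b1 - b2 + n - 1))),                 *)
(*   H_n = tau_n' / tau_n.                                                    *)
(* The powers have non-integer exponents and need not exist in L, so the      *)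
(* relation is stated after taking logarithmic derivatives.                   *)
Definition is_T (b : params L) (n : nat) (Hn T : L) : Prop :=
  T != 0 /\
  D T / T = Hn + (b1 b + b4 b) * (b1 b + b2 b + n%:R - 1) / t
               + (b1 b + b4 b) * (b1 b - b2 b + n%:R - 1) / (t - 1).

Variables (r s : L) (m : nat).

Definition seed_params : params L :=
  Params ((m%:R + r + 1) / 2%:R) ((m%:R - r + 2%:R * s - 1) / 2%:R)
         ((r + m%:R - 1) / 2%:R) ((m%:R - r - 1) / 2%:R).

Definition hypergeom : L :=
  \sum_(j < m.+1) (-1) ^+ j * gbinom (r + j%:R - 1) j * ('C(m, j))%:R
                  * (gbinom (s + j%:R - 1) j)^-1 * t ^+ j.

Definition q0 : L := t + t * (t - 1) / r * (D hypergeom / hypergeom).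

Definition q1 : L :=
  let b := seed_params in
  (b1 b + b2 b) * t * (q0 - 1)
  / ((2%:R * b1 b * t + b2 b - b1 b) * q0 - (b1 b + b2 b) * t).

Definition H0 : L := hamiltonian seed_params q0 (conjugate seed_params q0).

(* On the seed this simplifies to                                             *)
(*   - (b1 + b2) (b1 + b4) / t - (b1 - b2) (b1 + b4) / (t - 1).               *)
Definition H1 : L := plus_H seed_params q0 H0.

Definition H2 : L := plus_H (plus_params seed_params) q1 H1.

Definition is_T2 (T : L) : Prop := is_T seed_params 2 H2 T.

Definition W : L :=
  \sum_(j < m.+1) (-1) ^+ j * gbinom (r + m%:R + 1 - j%:R) (m - j)
                  * gbinom (s + m%:R) j * t ^+ (m - j).

End Okamoto.

(* Main.v *)
Require Import Defs.
From HB Require Import structures.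
From mathcomp Require Import all_boot all_order all_algebra.
From mathcomp Require Import ring.

(* Put z = 2F1(r, -m, s; t) and u = z' / (r z). The hypergeometric equation   *)
(* makes u a solution of a Riccati equation, so H_1, q_1 and H_2 are rational *)
(* functions of t and u with u' eliminated, and the logarithmic derivative of *)
(* T_2 is that of r z ((m+r+1) + ((m+r+1) t + s-1-r) u), the denominator of   *)
(* q_1 times r z. This is a contiguity relation: it equals, up to a constant, *)
(* 2F1(r+2, -m, s+1; t), and so does W, as both satisfy the same two-term     *)
(* recurrence. Since t is transcendental over the constants, no denominator   *)
(* vanishes.                                                                  *)

Set Implicit Arguments.
Unset Strict Implicit.
Unset Printing Implicit Defensive.

Import GRing.Theory.
Local Open Scope ring_scope.

(** With u = z'/(r z) the seed is q = t(1 + (t-1)u). Then [u] drops out of H_1 ([H1E]), q_1 = A/B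
    with A and B affine in [u] ([q1E]), and the Riccati equation [D_seed_u] turns T_2'/T_2 into r u
    + B'/B. As r u = z'/z, this is the logarithmic derivative of V = r z B ([horner_V],
    [T2_logarithmic_derivative]). Up to a constant, the coefficients of V are those of z times
    (r+i)(r+i+1)/(s+i) ([contiguous_hypergeometric]), so V and W obey the same recurrence and are
    proportional ([W_multiple_V]). A logarithmic derivative determines its function up to a constant
    ([logarithmic_derivative_eq]), which gives both directions. Apart from t, t - 1 and constants,
    every denominator reduces to a combination of z and z' that is nonzero at t = 0
    ([seed_combination_neq0]). *)

(** * Constants of a derivation, and transcendence of t over them *)

Section Constants.
Variables (L : fieldType) (D : L -> L).
Implicit Type derD : derivation D.

Lemma derivationD derD x y : D (x + y) = D x + D y.
Proof. exact: derD.1. Qed.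

Lemma derivationM derD x y : D (x * y) = D x * y + x * D y.
Proof. exact: derD.2. Qed.

Lemma derivation0 derD : D 0 = 0.
Proof. by apply: (addrI (D 0)); rewrite -derivationD // !addr0. Qed.

Lemma derivation1 derD : D 1 = 0.
Proof.
apply: (addrI (D 1)).
by rewrite addr0 -{3}[1]mulr1 derivationM // mulr1 mul1r.
Qed.

Lemma derivationN derD x : D (- x) = - D x.
Proof. by apply: (addrI (D x)); rewrite -derivationD // !subrr derivation0. Qed.

Lemma derivationB derD x y : D (x - y) = D x - D y.
Proof. by rewrite derivationD // derivationN. Qed.

Lemma derivation_div derD x y :
  y != 0 -> D (x / y) = (D x * y - x * D y) / y ^+ 2.
Proof.
move=> y0; have : D (x / y * y) = D x by rewrite divfK.
by rewrite derivationM // => <-; field.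
Qed.

(* The derivation is carried by the predicate so that its closure properties  *)
(* can be registered as a canonical structure.                                *)
Definition constants derD : {pred L} := fun x => D x == 0.

Lemma constantsP derD x : reflect (D x = 0) (x \in constants derD).
Proof. exact: eqP. Qed.

Fact constants_divring_closed derD : divring_closed (constants derD).
Proof.
split=> [|x y /constantsP Dx /constantsP Dy|x y /constantsP Dx /constantsP Dy];
  apply/constantsP; first exact: derivation1.
  by rewrite derivationB // Dx Dy subr0.
have [->|y0] := eqVneq y 0; first by rewrite invr0 mulr0 derivation0.
by rewrite derivation_div // Dx Dy mul0r mulr0 subr0 mul0r.
Qed.

HB.instance Definition _ derD :=
  GRing.isDivringClosed.Build L (constants derD) (constants_divring_closed derD).

Lemma logarithmic_derivative_eq derD x y : y != 0 ->
  (x != 0 /\ D x / x = D y / y) <-> exists c, [/\ c != 0, D c = 0 & x = c * y].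
Proof.
move=> y0; split=> [[x0 exy]|[c [c0 Dc ->]]].
  exists (x / y); rewrite mulf_neq0 ?invr_neq0 ?divfK //; split=> //.
  rewrite derivation_div //.
  have -> : D x = D y / y * x by rewrite -exy divfK.
  by field.
split; first by rewrite mulf_neq0.
by rewrite derivationM // Dc; field; rewrite y0.
Qed.

Lemma gbinom_const derD x k :
  x \in constants derD -> gbinom x k \in constants derD.
Proof.
by move=> xK; rewrite rpred_div ?rpred_nat // rpred_prod // => i _;
   rewrite rpredB ?rpred_nat.
Qed.

Lemma derivation_horner derD (t : L) (P : {poly L}) :
  D t = 1 -> P \is a polyOver (constants derD) -> D P.[t] = P^`().[t].
Proof.
move=> Dt /polyOverP; elim/poly_ind: P => [|P c IHP] Pc.
  by rewrite deriv0 !horner0 derivation0.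
have Dc : D c = 0 by have /constantsP := Pc 0; rewrite coefD coefMX coefC add0r.
have Pc' i : P`_i \in constants derD.
  by have := Pc i.+1; rewrite coefD coefMX coefC addr0.
rewrite derivD derivM derivX derivC !hornerE derivationD // derivationM //.
by rewrite IHP // Dt Dc; ring.
Qed.

(** Differentiating P(t) = 0 gives P'(t) = 0, so P' = 0 by induction on the size; in characteristic
    zero P is then a constant, equal to its value 0. *)
Lemma const_root derD (t : L) (P : {poly L}) :
    (forall n, n.+1%:R != 0 :> L) -> D t = 1 ->
  P \is a polyOver (constants derD) -> P.[t] = 0 -> P = 0.
Proof.
move=> char0 Dt.
elim: {P}(size P) {-2}P (leqnn (size P)) => [|n IHn] P.
  by rewrite leqn0 size_poly_eq0 => /eqP.
move=> szP PK Pt0.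
have dP0 : P^`() = 0.
  apply: IHn; last by rewrite -(derivation_horner Dt PK) Pt0 derivation0.
    by apply/leq_sizeP => i ni; rewrite coef_deriv (leq_sizeP _ _ szP) ?mul0rn.
  exact: polyOver_deriv.
suff PC : P = (P`_0)%:P by move: Pt0; rewrite PC hornerC => ->.
apply/polyP => -[|i]; rewrite coefC //=.
have /eqP := congr1 (fun Q : {poly L} => Q`_i) dP0.
by rewrite coef_deriv coef0 -mulr_natr mulf_eq0 (negPf (char0 i)) orbF => /eqP.
Qed.

(** An element of [L] cannot be evaluated at t = 0, but the polynomial representing it can. *)
Lemma horner_const_neq0 derD (t : L) (P : {poly L}) :
    (forall n, n.+1%:R != 0 :> L) -> D t = 1 ->
  P \is a polyOver (constants derD) -> P.[0] != 0 -> P.[t] != 0.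
Proof.
move=> char0 Dt PK; apply: contraNneq => /(const_root char0 Dt PK) ->.
by rewrite horner0.
Qed.

End Constants.

(** * Affine integer relations and certificates for identities *)

Lemma indeterminates_affine (L : fieldType) (r s : L) (a b c : int) :
    indeterminates r s ->
  a%:~R * r + b%:~R * s + c%:~R = 0 -> [/\ a = 0, b = 0 & c = 0].
Proof.
move=> indep eq0.
(* The outer variable stands for [r], the inner one for [s]. *)
pose P : {poly {poly int}} := a%:P%:P * 'X + (b%:P * 'X + c%:P)%:P.
have /polyP P0 : P = 0.
  apply: indep.
  pose phi : {rmorphism {poly int} -> {poly L}} := map_poly (intr : int -> L).
  rewrite -[map_poly (map_poly _)]/(map_poly phi) /P rmorphD rmorphM /=.
  rewrite !(map_polyC, map_polyX) /= !(rmorphD, rmorphM) /=.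
  by rewrite !(map_polyC, map_polyX) /= !hornerE.
have := P0 1%N; rewrite /P coefD coefCM coefX coefC mulr1 addr0 coef0 => /eqP.
rewrite polyC_eq0 => /eqP ->.
have := P0 0; rewrite /P coefD coefCM coefX coefC mulr0 add0r coef0 => /polyP Q0.
split=> //; [have := Q0 1%N | have := Q0 0];
  by rewrite coefD coefCM coefX coefC coef0 ?mulr1 ?mulr0 ?addr0 ?add0r.
Qed.

(** Reduces a goal to a ring identity, given the cofactor [k] of a known relation. *)
Lemma eq_of_multiple (R : pzRingType) (k l r x y : R) :
  l = r -> x - y = k * (l - r) -> x = y.
Proof. by move=> ->; rewrite subrr mulr0 => /subr0_eq. Qed.

(** * Polynomials with hypergeometric coefficient recurrences *)

Section HypergeometricPolynomials.
Variable L : fieldType.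
Implicit Types (a b c t : L) (P Q : {poly L}).

(** The recurrence of 2F1(a, b; c), without division or normalization, hence stable under
    scaling. *)
Definition hypergeometric_poly a b c P :=
  forall i, (c + i%:R) * i.+1%:R * P`_i.+1 = (a + i%:R) * (b + i%:R) * P`_i.

Lemma hypergeometric_poly_unique a b c P Q :
    (forall n, n.+1%:R != 0 :> L) -> (forall i : nat, c + i%:R != 0) ->
    hypergeometric_poly a b c P -> hypergeometric_poly a b c Q ->
  Q`_0 *: P = P`_0 *: Q.
Proof.
move=> char0 c0 hP hQ; apply/polyP; elim=> [|i IHi]; first by rewrite !coefZ mulrC.
have ci0 : (c + i%:R) * i.+1%:R != 0 by rewrite mulf_neq0.
rewrite !coefZ; apply: (mulfI ci0); rewrite mulrCA hP [RHS]mulrCA hQ mulrCA [RHS]mulrCA.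
by congr (_ * _); rewrite -!coefZ.
Qed.

Lemma coef_Euler P i : ('X * P^`())`_i = i%:R * P`_i.
Proof.
by case: i => [|i]; rewrite coefXM ?mul0r //= coef_deriv mulr_natl.
Qed.

Lemma hypergeometric_ode a b c t P : hypergeometric_poly a b c P ->
  t * (t - 1) * P^`(2).[t]
  = (c - (a + b + 1) * t) * P^`().[t] - a * b * P.[t].
Proof.
move=> hP.
(* With theta = X d/dX: (theta + c) P' = (theta + a) (theta + b) P.           *)
have : 'X * P^`()^`() + c%:P * P^`() =
  'X * ('X * P^`() + b%:P * P)^`() + a%:P * ('X * P^`() + b%:P * P).
  apply/polyP => i; rewrite !(coefD, coefCM, coef_Euler) coef_deriv.
  by apply: (eq_of_multiple (k := 1) (hP i)); ring.
move/(congr1 (fun Q => Q.[t])).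
rewrite derivD !derivM derivX derivC !hornerE /= => ode.
by apply: (eq_of_multiple (k := -1) ode); ring.
Qed.

(* 2F1(a + 2, b, c + 1) up to a factor, when P is 2F1(a, b, c). *)
Definition contiguous_poly a b c P : {poly L} :=
  (a * (1 + a - b))%:P * P + ((1 + a - b)%:P * 'X + (c - 1 - a)%:P) * P^`().

(** The combination multiplies the i-th coefficient by (c-b)(a+i)(a+i+1)/(c+i), which shifts a by 2
    and c by 1 in the recurrence. *)
Lemma contiguous_hypergeometric a b c P : (forall i : nat, c + i%:R != 0) ->
    hypergeometric_poly a b c P ->
  hypergeometric_poly (a + 2%:R) b (c + 1) (contiguous_poly a b c P).
Proof.
move=> c0 hP.
have coefV i : (c + i%:R) * (contiguous_poly a b c P)`_i =
  (c - b) * (a + i%:R) * (a + i%:R + 1) * P`_i.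
  rewrite /contiguous_poly [_ * P^`()]mulrDl -[_ * P^`()]mulrA.
  rewrite !(coefD, coefCM, coef_Euler) coef_deriv.
  by apply: (eq_of_multiple (k := c - 1 - a) (hP i)); ring.
move=> i; apply: (mulfI (c0 i)).
set v := contiguous_poly a b c P in coefV *.
transitivity ((c + i%:R) * i.+1%:R * ((c + i.+1%:R) * v`_i.+1)); first by ring.
transitivity ((a + 2%:R + i%:R) * (b + i%:R) * ((c + i%:R) * v`_i)); last by ring.
rewrite !coefV.
apply: (eq_of_multiple (k := (c - b) * (a + i%:R + 1) * (a + i%:R + 2%:R)) (hP i)).
by ring.
Qed.

End HypergeometricPolynomials.

(** * Generalized binomial coefficients *)

Section Binomials.
Variable L : fieldType.
Hypothesis char0 : forall n, n.+1%:R != 0 :> L.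

Lemma fact_neq0 k : (k`!)%:R != 0 :> L.
Proof. by rewrite -(prednK (fact_gt0 k)). Qed.

Lemma gbinom0 (x : L) : gbinom x 0 = 1.
Proof. by rewrite /gbinom big_ord0 fact0 divr1. Qed.

Lemma gbinomS (x : L) k : k.+1%:R * gbinom x k.+1 = (x - k%:R) * gbinom x k.
Proof.
rewrite /gbinom big_ord_recr /= factS natrM.
by field; rewrite nat1r char0 fact_neq0.
Qed.

Lemma gbinomSS (x : L) k : k.+1%:R * gbinom (x + 1) k.+1 = (x + 1) * gbinom x k.
Proof.
rewrite /gbinom big_ord_recl subr0 factS natrM.
under eq_bigr => i _ do rewrite lift0 -natr1 opprD addrACA subrr addr0.
by field; rewrite nat1r char0 fact_neq0.
Qed.

Lemma gbinom_neq0 (x : L) k :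
  (forall i, (i < k)%N -> x - i%:R != 0) -> gbinom x k != 0.
Proof.
move=> x0; rewrite mulf_neq0 ?invr_neq0 ?fact_neq0 //.
by apply/prodf_neq0 => i _; apply: x0.
Qed.

End Binomials.

(** * The polynomials behind z and W *)

Section SeedSolution.
Variables (L : fieldType) (D : L -> L) (r s t : L) (m : nat).
Hypotheses (derD : derivation D) (Dr : D r = 0) (Ds : D s = 0) (Dt : D t = 1).
Hypotheses (char0 : forall n, n.+1%:R != 0 :> L).
Hypotheses (s0 : forall i : nat, s + i%:R != 0).

Let K := constants derD.

Lemma s_neq0 : s != 0.
Proof. by have := s0 0; rewrite addr0. Qed.

Let derivE := (derivationM derD, derivationD derD, derivationN derD,
  derivation1 derD).

Fact r_const : r \in K. Proof. exact/constantsP. Qed.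
Fact s_const : s \in K. Proof. exact/constantsP. Qed.

Definition seed_poly : {poly L} :=
  \poly_(j < m.+1) ((-1) ^+ j * gbinom (r + j%:R - 1) j * ('C(m, j))%:R
                    * (gbinom (s + j%:R - 1) j)^-1).

(** The sum [W] reversed, so that the index is the exponent of t. *)
Definition W_poly : {poly L} :=
  \poly_(i < m.+1) ((-1) ^+ (m - i) * gbinom (r + 1 + i%:R) i
                    * gbinom (s + m%:R) (m - i)).

Lemma horner_seed_poly : seed_poly.[t] = hypergeom t r s m.
Proof. by rewrite horner_poly. Qed.

Lemma horner_W_poly : W_poly.[t] = W t r s m.
Proof.
rewrite horner_poly /W (reindex_inj rev_ord_inj) /=.
apply: eq_bigr => j _; rewrite subSS.
have jm : (j <= m)%N by rewrite -ltnS.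
rewrite subKn //; congr (_ * gbinom _ _ * _ * _).
by rewrite natrB //; ring.
Qed.

Lemma gbinom_s_neq0 j : gbinom (s + j%:R - 1) j != 0.
Proof.
apply: gbinom_neq0 => // i ij.
suff -> : s + j%:R - 1 - i%:R = s + (j - i.+1)%:R by [].
by rewrite natrB // -natr1; ring.
Qed.

Lemma seed_poly_const : seed_poly \is a polyOver K.
Proof.
have [rK sK] := (r_const, s_const).
apply/polyOver_poly => j _.
have gK x : x \in K -> gbinom (x + j%:R - 1) j \in K.
  by move=> xK; rewrite gbinom_const ?rpredB ?rpredD ?rpred1 ?rpred_nat.
apply: rpredM; last by rewrite rpredV gK.
apply: rpredM; last exact: rpred_nat.
by apply: rpredM; [rewrite rpredX ?rpredN ?rpred1 | apply: gK].
Qed.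

Lemma coef_seed_poly j : seed_poly`_j =
  (-1) ^+ j * gbinom (r + j%:R - 1) j * ('C(m, j))%:R
  * (gbinom (s + j%:R - 1) j)^-1.
Proof.
by rewrite coef_poly; case: ltnP => // mj; rewrite bin_small // mulr0 mul0r.
Qed.

Lemma coef0_seed_poly : seed_poly`_0 = 1.
Proof. by rewrite coef_seed_poly !gbinom0 bin0 invr1 !mulr1. Qed.

Lemma seed_poly_hypergeometric : hypergeometric_poly r (- m%:R) s seed_poly.
Proof.
move=> i; rewrite !coef_seed_poly.
have si := gbinom_s_neq0 i; have si1 := gbinom_s_neq0 i.+1.
have sS := gbinomSS char0 (s + i%:R - 1) i.
have rS := gbinomSS char0 (r + i%:R - 1) i.
have eS x : x + i%:R - 1 + 1 = x + i.+1%:R - 1 :> L by ring.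
have binS : i.+1%:R * ('C(m, i.+1))%:R = (m%:R - i%:R) * ('C(m, i))%:R :> L.
  have [im|mi] := leqP i m; first by rewrite -natrB // -!natrM mul_bin_left.
  by rewrite !bin_small ?mulr0 // ltnW.
rewrite !eS in sS rS.
set gs := gbinom (s + i%:R - 1) i in si sS *.
set gs' := gbinom (s + i.+1%:R - 1) i.+1 in si1 sS *.
set gr := gbinom (r + i%:R - 1) i in rS *.
have -> : s + i%:R = i.+1%:R * gs' / gs by rewrite sS mulfK // -eS; ring.
transitivity (- ((-1) ^+ i) * ((r + i.+1%:R - 1) * gr)
  * ((m%:R - i%:R) * ('C(m, i))%:R) / gs); last by ring.
rewrite -rS -binS exprS.
by field; apply/andP.
Qed.

Lemma W_poly_hypergeometric :
  hypergeometric_poly (r + 2%:R) (- m%:R) (s + 1) W_poly.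
Proof.
move=> i; rewrite !coef_poly !ltnS.
(* At i = m the recurrence stops because the factor -m + i vanishes. *)
have [im|mi|->] := ltngtP i m; last 2 first.
- by rewrite !mulr0.
- by rewrite mulr0 addNr mulr0 mul0r.
have := gbinomSS char0 (r + 1 + i%:R) i.
have := gbinomS char0 (s + m%:R) (m - i.+1).
rewrite subnSK // !natrB ?(ltnW im) //.
rewrite -[in (-1) ^+ (m - i)](subnSK im) exprS.
have -> : r + 1 + i.+1%:R = r + 1 + i%:R + 1 by ring.
move=> sS rS.
transitivity ((-1) ^+ (m - i.+1) * (s + m%:R - (m%:R - i.+1%:R)) *
  gbinom (s + m%:R) (m - i.+1) * (i.+1%:R * gbinom (r + 1 + i%:R + 1) i.+1)).
  by ring.
by rewrite rS -[X in X * (_ * _)]mulrA -sS; ring.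
Qed.

(** * Nonvanishing of the denominators *)

Hypotheses (m0 : m%:R != 0 :> L) (r0 : r != 0) (r10 : r + 1 != 0).
Hypotheses (r1s0 : r + 1 - s != 0).

Let z := hypergeom t r s m.
Let w := D z.

(** At t = 0, z is 1 and z' is -m r/s, so the value there is a0 - (m r/s) b0. *)
Lemma seed_combination_neq0 (a0 a1 b0 b1 b2 : L) :
    all (mem K) [:: a0; a1; b0; b1; b2] -> s * a0 - m%:R * r * b0 != 0 ->
  (a0 + a1 * t) * z + (b0 + b1 * t + b2 * t ^+ 2) * w != 0.
Proof.
case/and5P => a0K a1K b0K b1K /andP[b2K _] ab0; have sn0 := s_neq0.
have PK := seed_poly_const; have dPK := polyOver_deriv PK.
pose A := a0%:P + a1%:P * 'X; pose B := b0%:P + b1%:P * 'X + b2%:P * 'X ^+ 2.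
have -> : (a0 + a1 * t) * z + (b0 + b1 * t + b2 * t ^+ 2) * w
    = (A * seed_poly + B * seed_poly^`()).[t].
  rewrite hornerD !hornerM -(derivation_horner Dt PK) horner_seed_poly.
  by rewrite !(hornerD, hornerM, hornerC, hornerX, horner_exp).
apply: (horner_const_neq0 (derD := derD)) => //.
  by do ?[apply: rpredD | apply: rpredM | apply: rpredX | rewrite polyOverC
     | apply: polyOverX].
have P'1 : seed_poly`_1 = - (m%:R * r / s).
  have := seed_poly_hypergeometric 0.
  rewrite !addr0 mulr1 coef0_seed_poly mulr1 mulrC => P1.
  by apply: (mulIf sn0); rewrite P1; field.
rewrite hornerD !hornerM ![seed_poly.[_]]horner_coef0 [_^`().[0]]horner_coef0.
rewrite coef_deriv coef0_seed_poly mulr1n P'1.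
rewrite !(hornerD, hornerM, hornerC, hornerX, horner_exp).
apply: contraNneq ab0 => ab0.
by apply/eqP/(eq_of_multiple (k := s) ab0); field.
Qed.

Lemma t_neq0 : t != 0.
Proof. by apply: contraTneq (oner_neq0 L) => t0; rewrite -Dt t0 derivation0 ?eqxx. Qed.

Lemma t_neq1 : t - 1 != 0.
Proof.
apply: contraTneq (oner_neq0 L) => /subr0_eq t1.
by rewrite -Dt t1 derivation1 ?eqxx.
Qed.

Let constE := (rpredD, rpredM, rpredN, rpred0, rpred1, rpred_nat,
  r_const, s_const).

Lemma hypergeom_neq0 : z != 0.
Proof.
have : (1 + 0 * t) * z + (0 + 0 * t + 0 * t ^+ 2) * w != 0.
  by apply: seed_combination_neq0; rewrite /= ?constE // mulr1 mulr0 subr0 s_neq0.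
by apply: contraNneq => z0; apply/eqP; ring: z0.
Qed.

Lemma D_hypergeom_neq0 : w != 0.
Proof.
have : (0 + 0 * t) * z + (1 + 0 * t + 0 * t ^+ 2) * w != 0.
  apply: seed_combination_neq0; rewrite /= ?constE //.
  by rewrite mulr1 mulr0 sub0r oppr_eq0 mulf_neq0.
by apply: contraNneq => w0; apply/eqP; ring: w0.
Qed.

(** Up to factors t and t - 1, the elements q - t, q - 1 and q are u, 1 + t u and 1 + (t-1) u. *)
Let u := w / (r * z).

Lemma seed_u_neq0 : u != 0.
Proof.
by rewrite mulf_neq0 ?D_hypergeom_neq0 // invr_neq0 // mulf_neq0 ?hypergeom_neq0.
Qed.

Lemma seed_1tu_neq0 : 1 + t * u != 0.
Proof.
have z0 := hypergeom_neq0.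
have : (r + 0 * t) * z + (0 + 1 * t + 0 * t ^+ 2) * w != 0.
  apply: seed_combination_neq0; rewrite /= ?constE //.
  by rewrite mulr0 subr0 mulf_neq0 ?s_neq0.
apply: contraNneq => u0; apply/eqP.
by apply: (eq_of_multiple (k := r * z) u0); rewrite /u; field; apply/andP.
Qed.

Lemma seed_1t1u_neq0 : 1 + (t - 1) * u != 0.
Proof.
have z0 := hypergeom_neq0.
have : (r + 0 * t) * z + (- 1 + 1 * t + 0 * t ^+ 2) * w != 0.
  apply: seed_combination_neq0; rewrite /= ?constE //.
  have -> : s * r - m%:R * r * - 1 = r * (s + m%:R) by ring.
  by rewrite mulf_neq0.
apply: contraNneq => u0; apply/eqP.
by apply: (eq_of_multiple (k := r * z) u0); rewrite /u; field; apply/andP.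
Qed.

(** Numerator and denominator of q_1 once t(t-1) is cancelled. *)
Let A := (m%:R + s) * (1 + t * u).
Let B := m%:R + r + 1 + ((m%:R + r + 1) * t + s - 1 - r) * u.

Let V := contiguous_poly r (- m%:R) s seed_poly.

Lemma D_hypergeomE : w = seed_poly^`().[t].
Proof. by rewrite /w /z -horner_seed_poly (derivation_horner Dt seed_poly_const). Qed.

Lemma horner_V : V.[t] = r * z * B.
Proof.
have z0 := hypergeom_neq0.
transitivity (r * (m%:R + r + 1) * z + ((m%:R + r + 1) * t + s - 1 - r) * w).
  rewrite /V /contiguous_poly D_hypergeomE /z -horner_seed_poly.
  by rewrite !(hornerD, hornerM, hornerC, hornerX); ring.
by rewrite /B /u; field; apply/andP.
Qed.

Lemma seed_B_neq0 : B != 0.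
Proof.
have z0 := hypergeom_neq0.
have : (r * (m%:R + r + 1) + 0 * t) * z
       + (s - 1 - r + (m%:R + r + 1) * t + 0 * t ^+ 2) * w != 0.
  apply: seed_combination_neq0; rewrite /= ?constE //.
  have -> : s * (r * (m%:R + r + 1)) - m%:R * r * (s - 1 - r)
    = r * (r + 1) * (s + m%:R) by ring.
  by rewrite !mulf_neq0.
apply: contraNneq => B0; apply/eqP.
by apply: (eq_of_multiple (k := r * z) B0); rewrite /B /u; field; apply/andP.
Qed.

Lemma seed_AB_neq0 : A - B != 0.
Proof.
have -> : A - B = - (r + 1 - s) * (1 + (t - 1) * u) by rewrite /A /B; ring.
by rewrite mulf_neq0 ?oppr_eq0 ?seed_1t1u_neq0.
Qed.

Lemma seed_AtB_neq0 : A - t * B != 0.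
Proof.
have z0 := hypergeom_neq0.
have : ((m%:R + s) * r - (m%:R + r + 1) * r * t) * z
       + (0 + (m%:R + r + 1) * t + - (m%:R + r + 1) * t ^+ 2) * w != 0.
  rewrite -mulNr.
  apply: seed_combination_neq0; rewrite /= ?constE //.
  by rewrite mulr0 subr0 !mulf_neq0 ?s_neq0 // addrC.
apply: contraNneq => AtB0; apply/eqP.
by apply: (eq_of_multiple (k := r * z) AtB0); rewrite /A /B /u; field; apply/andP.
Qed.

(** * The Riccati equation and the first two Okamoto steps *)

Lemma D_seed_u :
  D u = ((s - (r - m%:R + 1) * t) * u + m%:R) / (t * (t - 1)) - r * u ^+ 2.
Proof.
have z0 := hypergeom_neq0; have t0 := t_neq0; have t1 := t_neq1.
have ode := hypergeometric_ode t seed_poly_hypergeometric.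
have PK := polyOver_deriv seed_poly_const.
have Dw : D w = ((s - (r - m%:R + 1) * t) * w + m%:R * r * z) / (t * (t - 1)).
  rewrite {1}D_hypergeomE (derivation_horner Dt PK) D_hypergeomE /z.
  rewrite -horner_seed_poly.
  apply: (mulfI (mulf_neq0 t0 t1)); rewrite ode.
  by field; rewrite t0 t1.
rewrite /u (derivation_div derD) ?mulf_neq0 // (derivationM derD) Dr Dw -/w.
by field; rewrite r0 z0 t0 t1.
Qed.

Fact two_neq0 : 2%:R != 0 :> L. Proof. exact: char0. Qed.

Lemma seed_params_sums (b := seed_params r s m) :
  (b1 b + b2 b = m%:R + s) * (b1 b - b2 b = r + 1 - s)
  * (b3 b + b4 b = m%:R - 1) * (b1 b + b3 b = m%:R + r) * (b1 b + b4 b = m%:R)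
  * (b2 b - b1 b = s - 1 - r) * (2%:R * b1 b = m%:R + r + 1).
Proof. by have two0 := two_neq0; do !split; rewrite /b /=; field. Qed.

Lemma plus_seed_params_sums (b := plus_params (seed_params r s m)) :
  (b1 b + b2 b = m%:R + s) * (b1 b - b2 b = r + 1 - s)
  * (b3 b + b4 b = m%:R) * (b1 b + b4 b = m%:R).
Proof. by have two0 := two_neq0; do !split; rewrite /b /=; field. Qed.

Lemma q0E : q0 D t r s m = t * (1 + (t - 1) * u).
Proof.
by have z0 := hypergeom_neq0; rewrite /q0 -/z -/w /u; field; apply/andP.
Qed.

Lemma D_q0 : D (q0 D t r s m) =
  1 + (2%:R * t - 1) * u + (s - (r - m%:R + 1) * t) * u + m%:R
  - t * (t - 1) * r * u ^+ 2.
Proof.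
have [t0 t1] := (t_neq0, t_neq1).
(* Generalizing [u] keeps the derivation rules from unfolding it. *)
rewrite q0E; move: (u) D_seed_u => v Dv.
by rewrite !derivE Dv Dt; field; rewrite t0 t1.
Qed.

Lemma q1E : q1 D t r s m = A / B.
Proof.
have B0 := seed_B_neq0; have t0 := t_neq0; have t1 := t_neq1.
rewrite /q1 -[_ * t + _ - _]addrA !seed_params_sums.
have -> : ((m%:R + r + 1) * t + (s - 1 - r)) * q0 D t r s m - (m%:R + s) * t
  = t * (t - 1) * B by rewrite q0E /B; ring.
by rewrite q0E /A; field; rewrite B0 t0 t1.
Qed.

Lemma H1E : H1 D t r s m =
  - (m%:R + s) * m%:R / t - (r + 1 - s) * m%:R / (t - 1).
Proof.
have [two0 t0 t1] := And3 two_neq0 t_neq0 t_neq1.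
have [u0 tu0 t1u0] := And3 seed_u_neq0 seed_1tu_neq0 seed_1t1u_neq0.
rewrite /H1 /plus_H /H0 /hamiltonian /conjugate !seed_params_sums D_q0 q0E.
have -> : t * (1 + (t - 1) * u) - 1 = (t - 1) * (1 + t * u) by ring.
have -> : t * (1 + (t - 1) * u) - t = t * (t - 1) * u by ring.
by field; rewrite two0 t0 t1 u0 tu0 t1u0.
Qed.

Lemma T2_logarithmic_derivative :
  H2 D t r s m + m%:R * (m%:R + s + 2%:R - 1) / t
  + m%:R * (r + 1 - s + 2%:R - 1) / (t - 1) = D V.[t] / V.[t].
Proof.
have [two0 t0 t1] := And3 two_neq0 t_neq0 t_neq1.
have [z0 B0 tu0] := And3 hypergeom_neq0 seed_B_neq0 seed_1tu_neq0.
have ms0 : m%:R + s != 0 by rewrite addrC.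
have [AB0 AtB0] := (seed_AB_neq0, seed_AtB_neq0).
have Dm : D m%:R = 0 by apply/(constantsP derD); rewrite rpred_nat.
have DA : D A = (m%:R + s) * (u + t * D u).
  by rewrite /A; move: (u) => v; rewrite !derivE Dm Ds Dt; ring.
have DB : D B = (m%:R + r + 1) * u + ((m%:R + r + 1) * t + s - 1 - r) * D u.
  by rewrite /B; move: (u) => v; rewrite !derivE Dm Dr Ds Dt; ring.
have -> : D V.[t] / V.[t] = r * u + D B / B.
  rewrite horner_V (derivationM derD) [D (r * z)](derivationM derD) Dr -/w.
  by rewrite /u; field; rewrite r0 z0 B0.
rewrite /H2 H1E /plus_H /conjugate !plus_seed_params_sums q1E.
have -> : A / B - 1 = (A - B) / B by field.
have -> : A / B - t = (A - t * B) / B by field.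
rewrite (derivation_div derD) // DA DB D_seed_u.
move: B0 AB0 AtB0; rewrite /A /B => B0 AB0 AtB0.
field.
by rewrite two0 t0 t1 tu0 ms0 B0 AB0 AtB0.
Qed.

(** * Proportionality to W and the conclusion *)

Lemma W_multiple_V : exists c, [/\ c != 0, D c = 0 & W t r s m = c * V.[t]].
Proof.
have s10 (i : nat) : s + 1 + i%:R != 0 by rewrite -addrA nat1r.
have V0E : V`_0 = r * (r + 1) * (s + m%:R) / s.
  have sn0 := s_neq0; have := seed_poly_hypergeometric 0.
  rewrite !addr0 mulr1 coef0_seed_poly mulr1 => P1.
  rewrite /V /contiguous_poly mulrDl -[_ * 'X * _]mulrA !(coefD, coefCM, coef_Euler).
  rewrite coef_deriv coef0_seed_poly mulr1n.
  by apply: (eq_of_multiple (k := (s - 1 - r) / s) P1); field.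
have W0E : W_poly`_0 = (-1) ^+ m * gbinom (s + m%:R) m.
  by rewrite coef_poly subn0 gbinom0 mulr1.
have V00 : V`_0 != 0 by rewrite V0E !mulf_neq0 ?invr_neq0 ?s_neq0.
have uniq : W_poly`_0 *: V = V`_0 *: W_poly.
  apply: (hypergeometric_poly_unique char0 s10 _ W_poly_hypergeometric).
  exact: contiguous_hypergeometric seed_poly_hypergeometric.
(* The recurrence leaves only the ratio of the constant terms free. *)
exists (W_poly`_0 / V`_0); split.
- rewrite mulf_neq0 ?invr_neq0 // W0E mulf_neq0 ?expf_neq0 ?oppr_eq0 ?oner_neq0 //.
  apply: gbinom_neq0 => // i im.
  by rewrite -addrA -natrB // ltnW.
- apply/(constantsP derD)/rpred_div.
    rewrite W0E rpredM ?rpredX ?rpredN ?rpred1 // gbinom_const //.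
    by rewrite rpredD ?rpred_nat ?s_const.
  rewrite V0E rpred_div ?s_const // !rpredM ?rpredD ?r_const ?s_const //.
    exact: rpred1.
  exact: rpred_nat.
rewrite -horner_W_poly; apply: (mulfI V00).
have := congr1 (fun P : {poly L} => P.[t]) uniq; rewrite !hornerZ => <-.
by field.
Qed.

Lemma is_T2E T :
  is_T2 D t r s m T <->
  exists c, [/\ c != 0, D c = 0 & T = c * W t r s m].
Proof.
have V0 : V.[t] != 0.
  by rewrite horner_V !mulf_neq0 ?hypergeom_neq0 ?seed_B_neq0.
have [c [c0 Dc Wc]] := W_multiple_V.
have W0 : W t r s m != 0 by rewrite Wc mulf_neq0.
rewrite /is_T2 /is_T !seed_params_sums T2_logarithmic_derivative.
suff -> : D V.[t] / V.[t] = D (W t r s m) / W t r s m.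
  exact: logarithmic_derivative_eq.
by rewrite Wc (derivationM derD) Dc; field; rewrite c0 V0.
Qed.

End SeedSolution.

Theorem proposition1 (L : fieldType) (D : L -> L) (r s t : L) (m : nat)
    (derD : derivation D) (Dr : D r = 0) (Ds : D s = 0) (Dt : D t = 1)
    (indep_rs : indeterminates r s) (m_gt0 : (0 < m)%N) (T : L) :
  is_T2 D t r s m T <->
  exists c : L, [/\ c != 0, D c = 0 & T = c * W t r s m].
Proof.
(* Each genericity condition excludes one affine integer relation; characteristic zero is the case
   of a pure constant. *)
have affine := indeterminates_affine indep_rs.
have char0 n : n.+1%:R != 0 :> L.
  apply/eqP => n0; have [] // := affine 0 0 n.+1%:Z.
  by rewrite !mul0r !add0r -pmulrn.
have s0 (i : nat) : s + i%:R != 0.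
  apply/eqP => si; have [] // := affine 0 1 i%:Z.
  by rewrite mul0r add0r mul1r -pmulrn.
have r0 : r != 0.
  apply/eqP => r0; have [] // := affine 1 0 0.
  by rewrite mul0r !addr0 mul1r.
have r10 : r + 1 != 0.
  apply/eqP => r1; have [] // := affine 1 0 1.
  by rewrite mul0r addr0 mul1r.
have r1s0 : r + 1 - s != 0.
  apply/eqP => r1s; have [] // := affine 1 (-1) 1.
  by rewrite mul1r mulN1r addrAC.
have m0 : m%:R != 0 :> L by rewrite -(prednK m_gt0).
exact: is_T2E.
Qed.
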